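(* Let $\mathbf{x}$ be a complementation-symmetric Rote sequence. Then $r_{\mathbf{x}}(n)=n+1$ for all $n\ge 0$.
   Context: A factor of a sequence is a finite contiguous block. For a finite word $u=u(1)\cdots u(m)$, its reversal is $u^R=u(m)\cdots u(1)$; $u$ and $v$ are reflectively equivalent if $v=u$ or $v=u^R$. The reflection complexity $r_{\mathbf{x}}(n)$ is the number of distinct length-$n$ factors of $\mathbf{x}$ up to reflective equivalence; $\rho_{\mathbf{x}}(n)$ is the number of distinct length-$n$ factors. A binary sequence $\mathbf{x}$ is a Rote sequence if $\rho_{\mathbf{x}}(n)=2n$ for all $n\ge1$. It is complementation-symmetric if whenever $w$ is a factor, so is $E(w)$, where $E$ is the morphism exchanging $0$ and $1$. *)

(* Defs.v *)
From mathcomp Require Import all_boot.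
From mathcomp Require Import boolp.

Set Implicit Arguments.
Unset Strict Implicit.
Unset Printing Implicit Defensive.

(* Sequences over a finite alphabet [T] are one-sided infinite, indexed from 0. *)

Definition is_factor (T : finType) (x : nat -> T) (w : seq T) : Prop :=
  exists i : nat, w = [seq x (i + j) | j <- iota 0 (size w)].

(* Being a factor is not decidable, hence the classical [`[< _ >]]. *)
Definition factors (T : finType) (x : nat -> T) (n : nat) : {set n.-tuple T} :=
  [set w : n.-tuple T | `[< is_factor x w >]].

Definition complexity (T : finType) (x : nat -> T) (n : nat) : nat :=
  #|factors x n|.

Definition refl_equiv (T : eqType) (n : nat) : rel (n.-tuple T) :=
  fun u v => (v == u) || (v == [tuple of rev u]).

Definition reflection_complexity (T : finType) (x : nat -> T) (n : nat) : nat :=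
  #|equivalence_partition (@refl_equiv T n) (factors x n)|.

(* Binary alphabet: [false] is the letter 0 and [true] the letter 1. *)

Definition rote (x : nat -> bool) : Prop :=
  forall n : nat, 1 <= n -> complexity x n = 2 * n.

Definition exchange (w : seq bool) : seq bool := map negb w.

Definition complementation_symmetric (x : nat -> bool) : Prop :=
  forall w : seq bool, is_factor x w -> is_factor x (exchange w).

(* Main.v *)
Require Import Defs.
From mathcomp Require Import all_boot.
From mathcomp Require Import boolp zify.

(** Let [y] be the sequence of differences of consecutive letters of [x] modulo
    2. Complementation symmetry makes [y] recurrent of complexity [n + 1], with
    exactly one right special factor of each length. From this the factors of
    [y] are closed under reversal, and each palindromic factor [u] of [y] has
    exactly one palindromic extension [a u a]. Both facts lift to [x] (for
    nonempty palindromes), so [x] has exactly two palindromic factors of each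
    positive length, and the number of reversal classes of its [2n] factors is
    [(2n + 2) / 2]. *)

Set Implicit Arguments.
Unset Strict Implicit.
Unset Printing Implicit Defensive.

(** * Windows, factors and recurrence *)

Definition window (T : Type) (x : nat -> T) (i n : nat) : seq T :=
  [seq x (i + j) | j <- iota 0 n].

Lemma size_window (T : Type) (x : nat -> T) (i n : nat) :
  size (window x i n) = n.
Proof. by rewrite size_map size_iota. Qed.

Lemma nth_window (T : Type) (d : T) (x : nat -> T) (i n j : nat) :
  j < n -> nth d (window x i n) j = x (i + j).
Proof. by move=> lt_jn; rewrite (nth_map 0) ?size_iota // nth_iota. Qed.

Lemma window_cat (T : Type) (x : nat -> T) (i m n : nat) :
  window x i (m + n) = window x i m ++ window x (i + m) n.
Proof.
rewrite /window iotaD map_cat add0n -{2}[m]addn0 iotaDl -map_comp.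
by congr (_ ++ _); apply: eq_map => j /=; rewrite addnA.
Qed.

Lemma window_cons (T : Type) (x : nat -> T) (i n : nat) :
  window x i n.+1 = x i :: window x i.+1 n.
Proof. by rewrite -add1n window_cat addn1 /window /= addn0. Qed.

Lemma window_rcons (T : Type) (x : nat -> T) (i n : nat) :
  window x i n.+1 = rcons (window x i n) (x (i + n)).
Proof. by rewrite -addn1 window_cat /window /= addn0 cats1. Qed.

Lemma window_factor (T : finType) (x : nat -> T) (i n : nat) :
  is_factor x (window x i n).
Proof. by exists i; rewrite size_window. Qed.

Lemma factor_catl (T : finType) (x : nat -> T) (u v : seq T) :
  is_factor x (u ++ v) -> is_factor x u.
Proof.
case=> i; rewrite size_cat -/(window _ _ _) window_cat => /eqP.
by rewrite eqseq_cat ?size_window // => /andP[/eqP-> _]; apply: window_factor.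
Qed.

Lemma factor_catr (T : finType) (x : nat -> T) (u v : seq T) :
  is_factor x (u ++ v) -> is_factor x v.
Proof.
case=> i; rewrite size_cat -/(window _ _ _) window_cat => /eqP.
by rewrite eqseq_cat ?size_window // => /andP[_ /eqP->]; apply: window_factor.
Qed.

Lemma factor_behead (T : finType) (x : nat -> T) (a : T) (w : seq T) :
  is_factor x (a :: w) -> is_factor x w.
Proof. by rewrite -cat1s => /factor_catr. Qed.

Lemma factor_belast (T : finType) (x : nat -> T) (a : T) (w : seq T) :
  is_factor x (rcons w a) -> is_factor x w.
Proof. by rewrite -cats1 => /factor_catl. Qed.

Lemma factor_rcons (T : finType) (x : nat -> T) (w : seq T) :
  is_factor x w -> exists a, is_factor x (rcons w a).
Proof.
case=> i ->; exists (x (i + size w)).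
by rewrite -/(window _ _ _) -window_rcons; apply: window_factor.
Qed.

Definition recurrent (T : Type) (x : nat -> T) : Prop :=
  forall i n, exists2 j, i < j & window x j n = window x i n.

Lemma recurrent_factor (T : finType) (x : nat -> T) (w : seq T) (m : nat) :
  recurrent x -> is_factor x w ->
  exists2 i, m <= i & w = window x i (size w).
Proof.
move=> xrec [i0 Ew]; elim: m => [|m [i le_mi Ewi]]; first by exists i0.
by have [j lt_ij Ej] := xrec i (size w); exists j; [lia | rewrite Ej].
Qed.

(** Recurrence provides an occurrence at a position at least 1, hence with a letter on its left. *)
Lemma factor_cons (T : finType) (x : nat -> T) (w : seq T) :
  recurrent x -> is_factor x w -> exists a, is_factor x (a :: w).
Proof.
move=> xrec /(recurrent_factor 1 xrec)[[//|i] _ ->].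
by exists (x i); rewrite -window_cons; apply: window_factor.
Qed.

Lemma mem_factors (T : finType) (x : nat -> T) (n : nat) (w : n.-tuple T) :
  (w \in factors x n) = `[< is_factor x w >].
Proof. by rewrite inE. Qed.

(** * Right special words and growth of complexity *)

Definition right_special (x : nat -> bool) (w : seq bool) : Prop :=
  forall a, is_factor x (rcons w a).

Lemma right_special_behead (x : nat -> bool) (a : bool) (w : seq bool) :
  right_special x (a :: w) -> right_special x w.
Proof. by move=> rs b; move: (rs b) => /factor_behead. Qed.

Lemma right_special2 (x : nat -> bool) (a : bool) (w : seq bool) :
  is_factor x (rcons w a) -> is_factor x (rcons w (~~ a)) -> right_special x w.
Proof. by case: a => ? ? []. Qed.

(** Deleting the last letter maps factors of length [n.+1] onto those of length [n]; a fibre has two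
    elements over a right special word and one otherwise. *)
Lemma complexity_succ (x : nat -> bool) (n : nat) :
  complexity x n.+1 =
  complexity x n + #|[set w : n.-tuple bool | `[< right_special x w >]]|.
Proof.
have rconsK : {on [pred w in factors x n.+1],
    bijective (fun p : n.-tuple bool * bool => [tuple of rcons p.1 p.2])}.
  pose h (w : n.+1.-tuple bool) : n.-tuple bool * bool :=
    ([tuple of belast (thead w) (behead w)], last (thead w) (behead w)).
  exists h => [[u b] _|w _]; last first.
    by apply/val_inj; rewrite /= -lastI [RHS](congr1 val (tuple_eta w)).
  rewrite /h; congr (_, _); last first.
    rewrite /thead (tnth_nth b) /=.
    by case: u => -[|c s] //= _; rewrite last_rcons.
  apply/val_inj; rewrite /= /thead (tnth_nth b) /=.
  by case: u => -[|c s] //= _; rewrite belast_rcons.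
rewrite /complexity -!sum1_card (reindex _ rconsK) /=.
rewrite (eq_bigl (fun p : n.-tuple bool * bool =>
  (p.1 \in predT) && ([tuple of rcons p.1 p.2] \in factors x n.+1))) //.
rewrite -(pair_big_dep predT
  (fun (w : n.-tuple bool) b => [tuple of rcons w b] \in factors x n.+1) (fun _ _ => 1)) /=.
rewrite big_mkcond [X in _ = X + _]big_mkcond [X in _ = _ + X]big_mkcond -big_split /=.
apply: eq_bigr => w _.
rewrite big_mkcond big_bool /= !mem_factors !in_set /=.
have -> : `[< is_factor x w >] =
    `[< is_factor x (rcons w true) >] || `[< is_factor x (rcons w false) >].
  apply/asboolP/orP => [/factor_rcons[[] h]|[] /asboolP/factor_belast //].
  - by left; apply/asboolP.
  - by right; apply/asboolP.
have -> : `[< right_special x w >] =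
    `[< is_factor x (rcons w true) >] && `[< is_factor x (rcons w false) >].
  apply/asboolP/andP => [rs|[/asboolP h1 /asboolP h0] []//].
  by split; apply/asboolP; apply: rs.
by case: `[< _ >]; case: `[< _ >].
Qed.

(** * Reversal and palindromes in recurrent Sturmian sequences *)

Definition sturmian (y : nat -> bool) : Prop := forall n, complexity y n = n.+1.

Lemma right_special_exists (y : nat -> bool) (n : nat) :
  sturmian y -> exists2 w : seq bool, size w = n & right_special y w.
Proof.
move=> st; have := complexity_succ y n; rewrite !st => /eqP.
rewrite -addn1 eqn_add2l eq_sym => /cards1P[w /setP/(_ w)].
by rewrite !inE eqxx => /asboolP rs; exists w; rewrite ?size_tuple.
Qed.

Lemma right_special_uniq (y : nat -> bool) (u v : seq bool) :
  sturmian y -> size u = size v -> right_special y u -> right_special y v ->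
  u = v.
Proof.
move=> st Euv; have := complexity_succ y (size v); rewrite !st => /eqP.
rewrite -addn1 eqn_add2l eq_sym => /cards1P[w /setP Ew] /asboolP ru /asboolP rv.
move: (Ew (Tuple (introT eqP Euv))) (Ew (in_tuple v)).
by rewrite !inE /= ru rv => /esym/eqP <- /esym/eqP [->].
Qed.

(* Otherwise [a :: w] is the only right special word of its length [n]; it does
   not start at any of the first [n + 1] positions of an occurrence of
   [~~ a w ~~ a], as [w] is a palindrome. By pigeonhole two of the [n + 1]
   windows there coincide, so that the sequence is periodic from there on and
   avoids [a :: w], against recurrence. *)
Lemma sturmian_palindrome_square (y : nat -> bool) (a : bool) (w : seq bool) :
  sturmian y -> recurrent y -> rev w = w ->
  is_factor y (a :: rcons w (~~ a)) -> is_factor y (~~ a :: rcons w (~~ a)) ->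
  is_factor y (a :: rcons w a) -> is_factor y (~~ a :: rcons w a).
Proof.
move=> st yrec palw Faa' [i] + Faa; move=> Ei.
have rsaw : right_special y (a :: w) by apply: (@right_special2 _ a).
set n := (size w).+1.
have {Ei} : ~~ a :: rcons w (~~ a) = window y i n.+1.
  by rewrite Ei /= size_rcons.
rewrite window_cons window_rcons => -[Ei /rcons_inj[Ew Eiw]].
have avoid k : i <= k <= i + n -> window y k n <> a :: w.
  rewrite /n window_cons => /andP[le_ik le_kin] [Ek Ekw].
  have [Eki|ltik] := leqP k i.
    have E : k = i by lia.
    by move: Ei; rewrite -E Ek; case: (a).
  have [ltkn|Ekn] := ltnP k (i + n); last first.
    have E : k = i.+1 + size w by lia.
    by move: Eiw; rewrite -E Ek; case: (a).
  have Ewj j : j < size w -> nth false w j = y (i.+1 + j).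
    by move=> ?; rewrite [in LHS]Ew nth_window.
  have Ewk j : j < size w -> nth false w j = y (k.+1 + j).
    by move=> ?; rewrite -[in LHS]Ekw nth_window.
  (* The left side is the index of position [i + n] in the copy of [w] at [k.+1]. Its mirror index
     is that of position [k] in the copy at [i.+1], so [y (i + n) = y k], whereas these letters are
     [~~ a] and [a]. *)
  have lt1 : i + n - k.+1 < size w by lia.
  move: (Ewk _ lt1).
  rewrite -[w in nth _ w _]palw nth_rev // Ewj; last by lia.
  rewrite (_ : i.+1 + _ = k); last by lia.
  rewrite (_ : k.+1 + _ = i.+1 + size w); last by lia.
  by rewrite Ek -Eiw; case: (a).
pose f (k : 'I_n.+1) : n.-tuple bool := Tuple (introT eqP (size_window y (i + k) n)).
have Ff k : f k \in factors y n.
  by rewrite mem_factors; apply/asboolP/window_factor.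
(* There are exactly [n.+1] factors of length [n], so [n.+1] distinct windows would include
   [a :: w]. *)
have /injectivePn [p [q neq_pq Efpq]] : ~~ injectiveb f.
  apply/negP => /injectiveP f_inj.
  have Ef : f @: [set: 'I_n.+1] = factors y n.
    apply/eqP; rewrite eqEcard; apply/andP; split.
      by apply/subsetP => _ /imsetP[k _ ->].
    by rewrite card_imset // cardsT card_ord -(st n).
  have sz : size (a :: w) == n by [].
  have : Tuple sz \in factors y n.
    by rewrite mem_factors; apply/asboolP; apply: factor_belast (rsaw a).
  rewrite -Ef => /imsetP[k _ /(congr1 val)/= Ek].
  by apply: (@avoid (i + k)) => //; have := ltn_ord k; lia.
wlog ltpq : p q neq_pq Efpq / p < q.
  move=> wl; have /orP[] : (p < q) || (q < p) by rewrite -neq_ltn.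
  - exact: wl.
  - by apply: wl; rewrite // eq_sym.
have {neq_pq} ltqn := ltn_ord q.
move/(congr1 val): Efpq => /= Epq.
pose d := q - p.
(* Period [d] propagates: the window at [k] is not [a :: w], by [avoid] if [k < d] and by
   periodicity otherwise. Hence it is not right special and determines its next letter. *)
have nosp k : window y (i + p + k) n <> a :: w /\
    window y (i + p + k) n = window y (i + p + k + d) n.
  elim/ltn_ind: k => k IH.
  have av : window y (i + p + k) n <> a :: w.
    have [ltkd|ledk] := ltnP k d; first by apply: avoid; rewrite /d in ltkd; lia.
    have [|avkd Ekd] := IH (k - d); first by rewrite /d in ledk *; lia.
    move: Ekd; rewrite (_ : i + p + (k - d) + d = i + p + k); last by lia.
    by move<-.
  split=> //; case: k => [|k] in IH av *.
    by rewrite addn0 Epq /d; congr window; lia.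
  have [avk Ek] := IH k (ltnSn k).
  have Eletter : y (i + p + k + n) = y (i + p + k + d + n).
    apply/eqP/negPn/negP => neq; apply: avk.
    apply: (right_special_uniq st) => //; first by rewrite size_window.
    apply: (@right_special2 _ (y (i + p + k + n))).
      by rewrite -window_rcons; apply: window_factor.
    rewrite (_ : ~~ _ = y (i + p + k + d + n)).
      by rewrite Ek -window_rcons; apply: window_factor.
    by move: neq; case: (y _); case: (y _).
  have : window y (i + p + k) n.+1 = window y (i + p + k + d) n.+1.
    by rewrite !(window_rcons _ _ n) Ek Eletter.
  by rewrite !(window_cons _ _ n) !addnS addSn => /(congr1 behead).
have [j le_j Ej] := recurrent_factor (i + p) yrec (factor_belast (rsaw a)).
by have [] := nosp (j - (i + p)); rewrite subnKC // -Ej.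
Qed.

(** Induction on length. For a factor [a w b], the words [rev w a] and [b rev w] are factors by
    induction. If extending them, on the left and on the right respectively, never gives
    [b rev w a], then [w] must be a palindrome, and either [a = b] or [sturmian_palindrome_square]
    applies. *)
Lemma sturmian_rev (y : nat -> bool) (w : seq bool) :
  sturmian y -> recurrent y -> is_factor y w -> is_factor y (rev w).
Proof.
move=> st yrec; move En: (size w) => n.
elim/ltn_ind: n w En => n IH [|a s] En //.
case/lastP: s => [//|w b] in En *; rewrite /= size_rcons in En.
have rev1 v : size v < n -> is_factor y v -> is_factor y (rev v).
  by move=> lt_vn; apply: (IH _ lt_vn).
move=> Fawb; rewrite rev_cons rev_rcons.
have Faw : is_factor y (a :: w).
  by move: Fawb; rewrite -rcons_cons => /factor_belast.
have Fwb : is_factor y (rcons w b) by apply: factor_behead Fawb.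
have F_a : is_factor y (rcons (rev w) a).
  by rewrite -rev_cons; apply: rev1 => //=; lia.
have Fb_ : is_factor y (b :: rev w).
  by rewrite -rev_rcons; apply: rev1 => //; rewrite size_rcons -En.
have [c Fc] := factor_rcons Fb_.
have [Eca|neq_ca] := eqVneq c a; first by rewrite -Eca.
have {neq_ca} Eca : c = ~~ a by case: (a) (c) neq_ca => -[].
have [e Fe] := factor_cons yrec F_a.
have [Eeb|neq_eb] := eqVneq e b; first by rewrite -Eeb.
have {neq_eb} Eeb : e = ~~ b by case: (b) (e) neq_eb => -[].
subst c e.
(* Both extensions went wrong, so [rev w] is followed by [a] and [~~ a], and, by induction once
   more, [w] by [b] and [~~ b]. Both are right special. *)
have palw : rev w = w.
  apply: (right_special_uniq st); first by rewrite size_rev.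
    by apply: (right_special2 F_a); apply: factor_behead Fc.
  apply: (right_special2 Fwb); rewrite -[w]revK -rev_cons.
  apply: rev1; first by rewrite /= size_rev; lia.
  by move: Fe; rewrite -rcons_cons => /factor_belast.
rewrite palw in Fc Fe *.
have [Eab|neq_ab] := eqVneq a b; first by rewrite -Eab in Fawb *.
have Eb : b = ~~ a by case: (a) (b) neq_ab => -[].
subst b; rewrite negbK in Fe.
exact: sturmian_palindrome_square.
Qed.

(* The right special word of length [size u + 1], when it ends in [u], is
   [c :: u] with exactly one [c]; closure under reversal then forces
   exactly one of [a u a] and [~~ a u ~~ a]. *)
Lemma sturmian_palindrome_extension (y : nat -> bool) (u : seq bool) (a : bool) :
  sturmian y -> recurrent y -> rev u = u -> is_factor y u ->
  is_factor y (a :: rcons u a) <-> ~ is_factor y (~~ a :: rcons u (~~ a)).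
Proof.
move=> st yrec palu Fu.
have rs_cons : right_special y u -> exists c, right_special y (c :: u).
  move=> rsu; have [[|c v]// [Ev] rsv] := right_special_exists (size u).+1 st.
  exists c; rewrite (right_special_uniq st (esym Ev) rsu) //.
  exact: right_special_behead rsv.
have revF b c : is_factor y (b :: rcons u c) -> is_factor y (c :: rcons u b).
  by move=> /(sturmian_rev st yrec); rewrite rev_cons rev_rcons palu.
split=> [Faa Fa'a'|nFa'].
  have rsu : right_special y u.
    by apply: (@right_special2 _ a); [apply: factor_behead Faa | apply: factor_behead Fa'a'].
  have [c rsc] := rs_cons rsu.
  have Fcc b : is_factor y (b :: rcons u b).
    by case: (a) Faa Fa'a'; case: (b).
  (* [c u ~~c] is a factor, hence so is its reversal [~~c u c]; together with [~~c u ~~c] this makes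
     [~~c u] right special as well. *)
  have : c :: u = ~~ c :: u.
    apply: (right_special_uniq st) => //.
    apply: (@right_special2 _ (~~ c)); first exact: Fcc.
    by rewrite negbK; apply/revF/rsc.
  by case=> /eqP; case: (c).
apply: contrapT => nFa.
have nF b : ~ is_factor y (b :: rcons u b).
  by case: (a) nFa nFa'; case: (b).
(* With no palindromic extension, [b u] can only be followed by [~~ b]. So [u] is right special, and
   the right special [c u] yields the excluded factor [c u c]. *)
have [b Fub] := factor_rcons Fu.
have Fbu : is_factor y (b :: u).
  by have := sturmian_rev st yrec Fub; rewrite rev_rcons palu.
have [e Fbue] := factor_rcons Fbu.
have Ee : e = ~~ b by case: (b) (e) Fbue => -[] // /nF.
have rsu : right_special y u.
  apply: (right_special2 Fub); rewrite -Ee.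
  exact: factor_behead Fbue.
by have [c /(_ c)/nF] := rs_cons rsu.
Qed.

(** * The difference sequence *)

Definition diff (x : nat -> bool) (i : nat) : bool := x i (+) x i.+1.

Lemma window_diff (x : nat -> bool) (i n : nat) :
  window (diff x) i n = pairmap addb (x i) (window x i.+1 n).
Proof.
elim: n i => [|n IH] i //.
by rewrite [LHS]window_cons IH [in RHS]window_cons.
Qed.

Lemma pairmap_addbK (a : bool) : cancel (pairmap addb a) (scanl addb a).
Proof. exact/pairmapK/addKb. Qed.

Lemma scanl_addbK (a : bool) : cancel (scanl addb a) (pairmap addb a).
Proof. exact/scanlK/addKb. Qed.

Lemma pairmap_addb_exchange (a : bool) (s : seq bool) :
  pairmap addb (~~ a) (exchange s) = pairmap addb a s.
Proof. by elim: s a => //= b s IH a; rewrite IH addbN addNb negbK. Qed.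

Definition differences (s : seq bool) : seq bool :=
  pairmap addb (head false s) (behead s).

Lemma differences_rcons (s : seq bool) (b : bool) :
  s != [::] -> differences (rcons s b) = rcons (differences s) (last false s (+) b).
Proof. by case: s => // a s _; rewrite /differences /= -!cats1 pairmap_cat. Qed.

Lemma differences_cons (s : seq bool) (b : bool) :
  s != [::] -> differences (b :: s) = (b (+) head false s) :: differences s.
Proof. by case: s. Qed.

Lemma differences_rev (s : seq bool) : differences (rev s) = rev (differences s).
Proof.
elim: s => // a [//|c s] IH.
rewrite rev_cons differences_rcons -?size_eq0 ?size_rev //.
by rewrite IH (@differences_cons (c :: s)) // rev_cons addbC rev_cons last_rcons.
Qed.

(** The differences determine a nonempty word up to complement, and the factors of [x] are closed
    under complement. *)
Lemma factor_differences (x : nat -> bool) (s : seq bool) :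
  complementation_symmetric x -> s != [::] ->
  is_factor x s <-> is_factor (diff x) (differences s).
Proof.
case: s => // a s xsym _; rewrite /differences /=; split=> [[i]|[i]].
  rewrite -/(window _ _ _) /= window_cons => -[-> ->].
  by rewrite -window_diff; apply: window_factor.
rewrite -/(window _ _ _) size_pairmap window_diff => E.
have [Ea|neq_a] := eqVneq a (x i).
  rewrite -Ea in E; rewrite (can_inj (pairmap_addbK a) E) Ea -window_cons.
  exact: window_factor.
have {neq_a} Ea : a = ~~ x i by case: (a) (x i) neq_a => -[].
rewrite -(pairmap_addb_exchange (x i)) -Ea in E.
rewrite (can_inj (pairmap_addbK a) E) Ea -[_ :: _]/(exchange (_ :: _)).
by rewrite -window_cons; apply/xsym/window_factor.
Qed.

Lemma complexity_diff (x : nat -> bool) (n : nat) :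
  complementation_symmetric x -> complexity x n.+1 = 2 * complexity (diff x) n.
Proof.
move=> xsym; pose f (p : bool * n.-tuple bool) := [tuple of p.1 :: scanl addb p.1 p.2].
have f_inj : injective f.
  move=> [a u] [b v] /(congr1 val)[/= -> /(can_inj (scanl_addbK b)) Euv].
  by congr (_, _); apply/val_inj.
have -> : complexity x n.+1 = #|f @: setX [set: bool] (factors (diff x) n)|.
  congr #|pred_of_set _|; apply/setP => w; rewrite mem_factors.
  apply/asboolP/imsetP => [|[[a u]]].
    case/tupleP: w => a s /(factor_differences xsym (s := a :: s) isT) Fs.
    exists (a, [tuple of pairmap addb a s]).
      by rewrite !inE; apply/asboolP.
    by apply/val_inj; rewrite /= pairmap_addbK.
  rewrite !inE /= => /asboolP Fu ->.
  by apply/factor_differences; rewrite // /differences /= scanl_addbK.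
by rewrite card_imset // cardsX cardsT card_bool.
Qed.

(** The complement of the prefix of length [i + n.+1] occurs at some [q], and [q > 0] because the
    first letters differ. Complementing preserves differences, so the window of [diff x] at [i]
    reappears at [q + i]. *)
Lemma recurrent_diff (x : nat -> bool) :
  complementation_symmetric x -> recurrent (diff x).
Proof.
move=> xsym i n.
have [q] := xsym _ (window_factor x 0 (i + n.+1)).
rewrite size_map size_window -/(window _ _ _) => Eq.
have q_gt0 : 0 < q.
  case: q Eq => //; rewrite addnS !window_cons => -[].
  by case: (x 0).
exists (q + i); first by lia.
move/esym/eqP: Eq; rewrite !window_cat /exchange map_cat add0n.
rewrite eqseq_cat ?size_map ?size_iota // => /andP[_ /eqP].
rewrite !window_cons => -[Ei Ew].
by rewrite !window_diff Ei Ew pairmap_addb_exchange.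
Qed.

(** * Transfer to Rote sequences *)

Lemma rote_diff_sturmian (x : nat -> bool) :
  rote x -> complementation_symmetric x -> sturmian (diff x).
Proof.
by move=> xrote xsym n; have := complexity_diff n xsym; rewrite xrote //; lia.
Qed.

Lemma rote_rev (x : nat -> bool) (w : seq bool) :
  rote x -> complementation_symmetric x -> is_factor x w -> is_factor x (rev w).
Proof.
move=> xrote xsym; have [->//|w_neq0] := eqVneq w [::].
move=> /(factor_differences xsym w_neq0) Fd; apply/(factor_differences xsym).
  by rewrite -size_eq0 size_rev size_eq0.
rewrite differences_rev.
exact: sturmian_rev (rote_diff_sturmian xrote xsym) (recurrent_diff xsym) Fd.
Qed.

(** A nonempty palindrome starts and ends with the same letter, so the differences of [b w b] extend
    those of [w] by one same letter on both sides, and this letter flips with [b]. *)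
Lemma rote_palindrome_extension (x : nat -> bool) (w : seq bool) (a : bool) :
  rote x -> complementation_symmetric x ->
  w != [::] -> rev w = w -> is_factor x w ->
  is_factor x (a :: rcons w a) <-> ~ is_factor x (~~ a :: rcons w (~~ a)).
Proof.
move=> xrote xsym w_neq0 palw Fw.
have Ehl : last false w = head false w.
  by rewrite -{1}palw; case: (w) => // c s; rewrite rev_cons last_rcons.
have Ed b : differences (b :: rcons w b) =
    (b (+) head false w) :: rcons (differences w) (b (+) head false w).
  rewrite differences_cons ?differences_rcons //; last by case: (w).
  by rewrite Ehl [_ (+) b]addbC; case: (w) w_neq0.
have EF b : is_factor x (b :: rcons w b) =
    is_factor (diff x) (differences (b :: rcons w b)).
  exact/propext/factor_differences.
rewrite !EF !Ed addNb.
apply: sturmian_palindrome_extension.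
- exact: rote_diff_sturmian.
- exact: recurrent_diff.
- by rewrite -differences_rev palw.
- exact/(factor_differences xsym w_neq0).
Qed.

(** * Counting palindromes and reversal classes *)

Definition palindromes (x : nat -> bool) (n : nat) : {set n.-tuple bool} :=
  [set w in factors x n | rev w == w].

Lemma mem_palindromes (x : nat -> bool) (n : nat) (w : n.-tuple bool) :
  (w \in palindromes x n) = `[< is_factor x w >] && (rev w == w).
Proof. by rewrite !inE. Qed.

Lemma card_palindromes_add2 (x : nat -> bool) (n : nat) :
  rote x -> complementation_symmetric x -> 0 < n ->
  #|palindromes x n.+2| = #|palindromes x n|.
Proof.
move=> xrote xsym n_gt0.
have neq0 (w : n.-tuple bool) : tval w != [::] by rewrite -size_eq0 size_tuple -lt0n.
pose g (w : seq bool) := `[< is_factor x (true :: rcons w true) >].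
(* [h] sends a palindromic factor to its unique palindromic extension; stripping both end letters
   inverts it. *)
pose h (w : n.-tuple bool) := [tuple of g w :: rcons w (g w)].
have h_inj : injective h.
  by move=> u v /(congr1 val)[_ /rcons_inj[Euv _]]; apply/val_inj.
rewrite -(card_imset _ h_inj); congr #|pred_of_set _|; apply/setP => w.
rewrite mem_palindromes; apply/andP/imsetP => [[/asboolP]|[u + ->]].
  case: w => -[//|a s0] sz; case/lastP: s0 => [//|s b] in sz * => /= Fs.
  have sz_s : size s == n by move: sz; rewrite /= size_rcons.
  rewrite rev_cons rev_rcons rcons_cons => /eqP[Eba /rcons_inj[pals _]].
  subst b; have Fs' := factor_belast (factor_behead Fs).
  exists (Tuple sz_s); first by rewrite mem_palindromes /= pals eqxx andbT; apply/asboolP.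
  have ext := rote_palindrome_extension true xrote xsym (neq0 (Tuple sz_s)) pals Fs'.
  apply/val_inj => /=; suff -> : a = g s by [].
  rewrite /g; case: (a) Fs => Fs; apply/esym; first exact/asboolP.
  by apply/asboolPn => /ext; apply.
rewrite mem_palindromes => /andP[/asboolP Fu /eqP palu] /=.
rewrite rev_cons rev_rcons palu; split=> //; apply/asboolP.
rewrite /g; case: asboolP => // nFu; apply: contrapT => nFu'.
by apply/nFu/(rote_palindrome_extension true xrote xsym (neq0 u) palu Fu).
Qed.

Lemma card_palindromes (x : nat -> bool) (n : nat) :
  rote x -> complementation_symmetric x -> 0 < n -> #|palindromes x n| = 2.
Proof.
move=> xrote xsym; elim/ltn_ind: n => -[|[|[|n]]] // IH _.
- have -> : palindromes x 1 = factors x 1.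
    apply/setP => -[[|a []]] // ?; rewrite mem_palindromes mem_factors.
    by rewrite /= [_ == _]eqxx andbT.
  exact: xrote.
(* The complexity 4 at length 2 exhausts all binary words, so the palindromes are [00] and [11]. *)
- have Ef : factors x 2 = setT.
    by apply/eqP; rewrite eqEcard subsetT cardsT card_tuple card_bool  -[#|factors x 2|]/(complexity x 2) xrote.
  pose f (a : bool) := [tuple a; a].
  have f_inj : injective f by move=> a b [].
  transitivity #|f @: [set: bool]|; last by rewrite card_imset // cardsT card_bool.
  congr #|pred_of_set _|; apply/setP => w.
  rewrite mem_palindromes -mem_factors Ef in_setT /=.
  apply/eqP/imsetP => [|[a _ ->//]].
  case/tupleP: w => a; case/tupleP => b t; rewrite tuple0 => -[-> _].
  by exists a => //; apply/val_inj.
- by rewrite card_palindromes_add2 // IH.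
Qed.

(* An equivalence class is [{w, rev w}], of size 1 or 2 according as [w] is a
   palindrome, so counting palindromes twice counts each class twice. *)
Lemma reflection_complexity_double (x : nat -> bool) (n : nat) :
  (forall w, is_factor x w -> is_factor x (rev w)) ->
  2 * reflection_complexity x n = complexity x n + #|palindromes x n|.
Proof.
move=> xrev; set L := factors x n.
have revK2 (u v : n.-tuple bool) : (v == [tuple of rev u]) = (u == [tuple of rev v]).
  by apply/eqP/eqP => ->; apply/val_inj; rewrite /= revK.
have eqv : {in L & &, equivalence_rel (@refl_equiv bool n)}.
  move=> u v w _ _ _; rewrite /refl_equiv eqxx; split=> //.
  case/orP => /eqP->; rewrite //.
  rewrite orbC; congr (_ || _); congr (_ == _); apply/val_inj.
  by rewrite /= revK.
have partL := equivalence_partitionP eqv.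
rewrite /complexity -/L /palindromes -!sum1_card.
have -> : \sum_(w in [set w in L | rev w == w]) 1 = \sum_(w in L) (rev w == w : nat).
  by rewrite big_mkcond [RHS]big_mkcond; apply: eq_bigr => w _; rewrite inE; case: (w \in L); case: eqP.
rewrite -big_split /= (set_partition_big _ partL) /=.
rewrite (eq_bigr (fun=> 2)); last first.
  move=> B /imsetP[u uL ->].
  have uRL : [tuple of rev u] \in L.
    by move: uL; rewrite !mem_factors => /asboolP/xrev/asboolP.
  have -> : [set v in L | refl_equiv u v] = [set u; [tuple of rev u]].
    apply/setP => v; rewrite in_set in_set2 /refl_equiv; apply: andb_idl.
    by case/orP => /eqP->.
  have [palu|npalu] := eqVneq (rev u) u.
    have -> : [tuple of rev u] = u by apply/val_inj.
    by rewrite setUid big_set1 palu eqxx.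
  rewrite big_setU1 ?big_set1 /=; last first.
    by rewrite inE -val_eqE /= eq_sym.
  by rewrite revK (eq_sym (tval u)) (negbTE npalu).
by rewrite sum_nat_const mulnC.
Qed.

Theorem theorem6p11 (x : nat -> bool) (hrote : rote x)
  (hsym : complementation_symmetric x) (n : nat) :
  reflection_complexity x n = n + 1.
Proof.
have := reflection_complexity_double n (fun w => @rote_rev x w hrote hsym).
case: n => [|n]; last by rewrite hrote // card_palindromes //; lia.
(* The Rote condition says nothing at length 0; there the empty word is the only factor and a
   palindrome. *)
have F0 : factors x 0 = setT.
  by apply/setP => w; rewrite mem_factors tuple0 in_setT; apply/asboolP; exists 0.
have -> : palindromes x 0 = setT.
  by apply/setP => w; rewrite inE F0 tuple0 !in_setT.
by rewrite /complexity F0 cardsT card_tuple; lia.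
Qed.
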